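(* For every positive integer $n$, the graph $C_6 \times K_n$ admits a $C_6$-decomposition.
   Context: $K_n$ is the complete graph on $n$ vertices, $C_k$ the cycle of length $k$. The tensor product $G \times H$ has vertex set $V(G)\times V(H)$, with $(g_1,h_1)$ adjacent to $(g_2,h_2)$ iff $g_1g_2 \in E(G)$ and $h_1h_2 \in E(H)$. A $C_k$-decomposition of a graph is a partition of its edge set into edge sets of subgraphs isomorphic to $C_k$. *)

(* Defs.v *)
From mathcomp Require Import all_boot.

Set Implicit Arguments.
Unset Strict Implicit.
Unset Printing Implicit Defensive.

Record sgraph := SGraph {
  vertex :> finType;
  adj : rel vertex;
  adj_sym : symmetric adj;
  adj_irr : irreflexive adj }.

Definition edges (G : sgraph) : {set {set G}} :=
  [set [set p.1; p.2] | p : G * G & adj p.1 p.2].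

Definition complete_rel (n : nat) : rel 'I_n := fun i j => i != j.

Lemma complete_sym n : symmetric (@complete_rel n).
Proof. by move=> i j; rewrite /complete_rel eq_sym. Qed.

Lemma complete_irr n : irreflexive (@complete_rel n).
Proof. by move=> i; rewrite /complete_rel eqxx. Qed.

Definition K (n : nat) : sgraph := SGraph (@complete_sym n) (@complete_irr n).

(* [ordS] is the cyclic successor, so for k >= 3 this is the cycle of length k.
   The conjunct [i != j] only matters for k = 1, where [ordS i = i]. *)
Definition cycle_rel (k : nat) : rel 'I_k :=
  fun i j => (i != j) && ((j == ordS i) || (i == ordS j)).

Lemma cycle_sym k : symmetric (@cycle_rel k).
Proof. by move=> i j; rewrite /cycle_rel eq_sym orbC. Qed.

Lemma cycle_irr k : irreflexive (@cycle_rel k).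
Proof. by move=> i; rewrite /cycle_rel eqxx. Qed.

Definition C (k : nat) : sgraph := SGraph (@cycle_sym k) (@cycle_irr k).

Definition tensor_rel (G H : sgraph) : rel (G * H)%type :=
  fun x y => adj x.1 y.1 && adj x.2 y.2.

Lemma tensor_sym G H : symmetric (@tensor_rel G H).
Proof. by move=> x y; rewrite /tensor_rel adj_sym (adj_sym x.2). Qed.

Lemma tensor_irr G H : irreflexive (@tensor_rel G H).
Proof. by move=> x; rewrite /tensor_rel adj_irr. Qed.

Definition tensor (G H : sgraph) : sgraph :=
  SGraph (@tensor_sym G H) (@tensor_irr G H).

Definition subgraph (G : sgraph) (V : {set G}) (E : {set {set G}}) : Prop :=
  E \subset edges G /\ (forall e, e \in E -> e \subset V).

(* The graph with vertex set V and edge set E is isomorphic to H: f is a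
   bijection from the vertices of H onto V preserving and reflecting edges. *)
Definition isomorphic_to (G : sgraph) (V : {set G}) (E : {set {set G}})
    (H : sgraph) : Prop :=
  exists f : H -> G,
    [/\ injective f, [set f x | x : H] = V
      & forall x y, adj x y = ([set f x; f y] \in E)].

Definition decomposition (H G : sgraph) (P : {set {set {set G}}}) : Prop :=
  partition P (edges G) /\
  (forall E, E \in P ->
     exists V : {set G}, subgraph V E /\ isomorphic_to V E H).

Definition has_decomposition (H G : sgraph) : Prop :=
  exists P : {set {set {set G}}}, decomposition H P.

(* Main.v *)
(** Let [H] be bipartite with 2-colouring [c].  For each ordered pair of
    distinct labels [(a, b)], labelling the vertices of colour [true] by [a] and
    those of colour [false] by [b] embeds [H] in [H x K_n].  An edge of [H x K_n]
    projects to an edge of [H], one endpoint of which has each colour, so its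
    labels determine the unique pair [(a, b)] whose copy of [H] contains it. *)

Require Import Defs.
From mathcomp Require Import all_boot.

Set Implicit Arguments.
Unset Strict Implicit.
Unset Printing Implicit Defensive.

Lemma edgesP (G : sgraph) (e : {set G}) :
  reflect (exists x y : G, adj x y /\ e = [set x; y]) (e \in edges G).
Proof.
apply: (iffP imsetP) => [[[x y]]|[x [y [xy ->]]]].
  by rewrite inE /= => xy ->; exists x, y.
by exists (x, y); rewrite ?inE.
Qed.

(** An unordered pair fixes its endpoints up to order, which [adj_sym] absorbs; [x = y] would
    collapse the pair to a singleton and create a loop. *)
Lemma set2_edges (G : sgraph) (x y : G) : ([set x; y] \in edges G) = adj x y.
Proof.
apply/edgesP/idP => [[u [v [uv exy]]]|xy]; last by exists x, y.
have nxy : x != y.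
  apply: contraTneq uv => xy; move/setP: exy => e2.
  have := e2 u; have := e2 v; rewrite xy !inE !eqxx !orbT !orbb.
  by move=> /eqP-> /eqP->; rewrite adj_irr.
have : x \in [set u; v] by rewrite -exy set21.
have : y \in [set u; v] by rewrite -exy set22.
rewrite !inE => /orP[]/eqP y_ /orP[]/eqP x_; move: nxy; rewrite x_ y_ ?eqxx //.
by rewrite adj_sym.
Qed.

Lemma imset_set2 (aT rT : finType) (f : aT -> rT) (x y : aT) :
  f @: [set x; y] = [set f x; f y].
Proof. by rewrite imsetU1 imset_set1. Qed.

Section BipartiteTensor.

Variables (H : sgraph) (c : H -> bool) (n : nat).
Hypothesis c_adj : forall x y : H, adj x y -> c x != c y.

Definition label (p : 'I_n * 'I_n) (x : H) : tensor H (K n) :=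
  (x, if c x then p.1 else p.2).

Definition label_edges (p : 'I_n * 'I_n) : {set {set tensor H (K n)}} :=
  [set label p @: (e : {set H}) | e in edges H].

Lemma label_inj p : injective (label p).
Proof. by move=> x y []. Qed.

(** Injectivity of [label p] lifts to sets of vertices, so no non-edge of [H] lands in the copy. *)
Lemma label_set2 p (x y : H) :
  ([set label p x; label p y] \in label_edges p) = adj x y.
Proof.
rewrite -imset_set2 mem_imset ?set2_edges //.
exact: imset_inj (@label_inj p).
Qed.

Lemma label_edges_sub p : p.1 != p.2 -> label_edges p \subset edges (tensor H (K n)).
Proof.
move=> np; apply/subsetP => _ /imsetP[_ /edgesP[x [y [xy ->]]] ->].
rewrite imset_set2 set2_edges /= /tensor_rel /= xy /= /complete_rel.
by move: (c_adj xy); case: (c x); case: (c y); rewrite //= eq_sym.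
Qed.

Lemma label_edges_inj p q e : e \in label_edges p -> e \in label_edges q -> p = q.
Proof.
move=> /imsetP[_ /edgesP[x [y [xy ->]]] ->] /imsetP[e' _ epq].
(* The first coordinate of a label is the vertex itself, so [label p z] can only be the [q]-label of
   the same [z]. *)
have eq_label z : z \in [set x; y] -> label p z = label q z.
  move=> ze; have : label p z \in label q @: e' by rewrite -epq imset_f.
  by case/imsetP=> w _ /[dup] [[<- _]].
have [ex] := eq_label x (set21 x y); have [ey] := eq_label y (set22 x y).
rewrite (surjective_pairing p) (surjective_pairing q).
(* The endpoints have opposite colours: one compares the first components of [p] and [q], the other
   the second. *)
by move: (c_adj xy) ex ey; case: (c x); case: (c y) => // _ -> ->.
Qed.

Lemma cover_label_edges e : e \in edges (tensor H (K n)) ->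
  exists2 p, p.1 != p.2 & e \in label_edges p.
Proof.
case/edgesP=> -[x a] [[y b] [/andP[/= xy ab] ->]].
exists (if c x then (a, b) else (b, a)).
  by case: (c x); rewrite //= eq_sym.
have:= label_set2 (if c x then (a, b) else (b, a)) x y; rewrite xy /label.
by move: (c_adj xy); case: (c x); case: (c y).
Qed.

(** The edge [x0 y0] keeps every copy of [H] nonempty, as the blocks of a partition must be. *)
Lemma bipartite_tensor_decomposition (x0 y0 : H) : adj x0 y0 ->
  has_decomposition H (tensor H (K n)).
Proof.
move=> xy0; pose D := [set p : 'I_n * 'I_n | p.1 != p.2].
exists (label_edges @: D); split; last first.
  move=> E /imsetP[p]; rewrite inE => np ->.
  exists [set label p x | x : H]; split; first split.
  - exact: label_edges_sub.
  - by move=> _ /imsetP[e _ ->]; apply/imsetS/subsetP.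
  - exists (label p); split=> [||x y] //; first exact: label_inj.
    by rewrite label_set2.
have ne0 : set0 \notin label_edges @: D.
  apply/negP=> /imsetP[p _ /setP /(_ [set label p x0; label p y0])].
  by rewrite inE label_set2 xy0.
apply/and3P; split=> //.
  apply/eqP/setP=> e; apply/bigcupP/idP => [[_ /imsetP[p + ->]]|].
    by rewrite inE => /label_edges_sub /subsetP; apply.
  case/cover_label_edges=> p np ep; exists (label_edges p) => //.
  by rewrite imset_f // inE.
apply: (proj1 (trivIimset _ ne0)).
move=> p q _ _; apply: contraNT => /pred0Pn[e /= /andP[ep eq]].
by apply/eqP; apply: label_edges_inj eq ep.
Qed.

End BipartiteTensor.

Theorem theorem5p3 (n : nat) (hn : 0 < n) :
  has_decomposition (C 6) (tensor (C 6) (K n)).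
Proof.
(* Parity is a proper colouring since 6 is even: the wrap-around from 5 to 0 also changes colour. *)
apply: (@bipartite_tensor_decomposition (C 6) (fun i : 'I_6 => odd i) n _
  (@Ordinal 6 0 isT) (@Ordinal 6 1 isT)) => // -[x hx] [y hy] /=.
move=> /andP[_ /orP[]/eqP/(congr1 val)/= ->].
  by move: x hx; do 6 case=> //.
by move: y hy; do 6 case=> //.
Qed.
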